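(* Let $K$ be an oriented, non-split alternating link in $S^3$. The Laurent polynomial $P_K(x,y,z,w)\in\mathbb{Z}[x^{-1},y^{-1},z,w]$ defined in the context is homogeneous, with degree equal to the signature $\sigma(K)$ of $K$.
   Context: Signature: $\sigma(K)$ is the signature of $V+V^{\top}$ for a Seifert matrix $V$ of $K$, with the convention that the trefoil with positive crossings has signature $-2$. Homogeneous of degree $d$ means that every monomial $x^ay^bz^cw^d{}'$ appearing with nonzero coefficient has total exponent $a+b+c+d'=d$. All links are oriented and non-split. A link is alternating if it has a diagram in which each component alternates between over- and undercrossings (an alternating diagram). Crossing signs: rotate the picture so both strands point upward; the crossing is positive if the overstrand runs from lower left to upper right, negative if it runs from lower right to upper left. Tait digraph. Let $D\subset\mathbb{R}^2$ be an alternating diagram of a non-split link. Regions of $D$ are the components of the complement of the underlying 4-valent plane graph. Choose the checkerboard shading of the regions such that at every crossing, when the picture is rotated so that the overstrand runs from lower left to upper right, the top and bottom regions are the shaded ones. The Tait digraph $G=(V,E)$ is the plane digraph with one vertex in each shaded region and one edge through each crossing, joining the vertices of the two shaded regions at that crossing (loops and multiple edges allowed), directed to match the overcrossing: rotating so that the overstrand is directed from lower left to upper right, the edge points from the bottom region to the top region. An edge is positive or negative according to the sign of its crossing; $E=E_+\sqcup E_-$. Activities. Fix a root vertex $r\in V$ and a basepoint $q\in\mathbb{R}^2\setminus G$. Let $T$ be a spanning tree of $G$ (viewed as a set of edges). An edge $e\in T$ is internally semi-active if it points away from the component of $T\setminus\{e\}$ containing $r$, and internally semi-passive otherwise. For $e\in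 E\setminus T$, let $\mathrm{Cyc}_T(e)$ be the unique cycle in $T\cup\{e\}$, oriented counter-clockwise around $q$ in $\mathbb{R}^2\cup\{\infty\}$ (so that the side containing $q$ lies on its left); $e$ is externally semi-active if its direction agrees with this orientation, and externally semi-passive otherwise. Let $\iota_+(T)$, $\overline{\iota}_+(T)$ be the numbers of internally semi-active, respectively semi-passive, edges in $T\cap E_+$, and $\varepsilon_-(T)$, $\overline{\varepsilon}_-(T)$ the numbers of externally semi-active, respectively semi-passive, edges in $E_-\setminus T$. The polynomial. For an alternating diagram $D$ of $K$ with Tait digraph $G$, a root $r$, and a basepoint $q$ in a face of $G$ adjacent to $r$ (its boundary contains $r$), $$P_K(x,y,z,w)=\sum_{T}x^{-\iota_+(T)}y^{-\overline{\iota}_+(T)}z^{\varepsilon_-(T)}w^{\overline{\varepsilon}_-(T)},$$ summed over all spanning trees $T$ of $G$. It does not depend on the choice of alternating diagram or of adjacent pair $(r,q)$. *)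

(* Defs.v *)
From HB Require Import structures.
From mathcomp Require Import all_boot all_order all_algebra all_field.
From mathcomp Require Import mpoly.

Set Implicit Arguments.
Unset Strict Implicit.
Unset Printing Implicit Defensive.

Import Order.TTheory GRing.Theory Num.Theory.
Local Open Scope ring_scope.

(* A diagram is a connected 4-valent plane graph with crossing data, encoded
   as a combinatorial map.  A dart (c, o, t) is one of the four strand ends at
   the crossing c: o tells whether it belongs to the overstrand, t whether it
   is outgoing (points away from c).  When the overstrand of c runs from lower
   left (SW) to upper right (NE), the understrand runs from SE to NW if c is
   positive, and from NW to SE if c is negative. *)

Definition dart (C : finType) : finType := (C * bool * bool)%type.

(* The next strand end counter-clockwise, SW -> SE -> NE -> NW -> SW. *)
Definition turn (C : finType) (pos : pred C) (d : dart C) : dart C :=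
  let: (c, o, t) := d in (c, ~~ o, if o == pos c then t else ~~ t).

(* The dart d also names the corner between d and turn d; regions are sets of
   corners.  Walking along the edge that starts with turn d, the region of the
   corner d stays on the right, and the next corner met is glue (turn d). *)
Definition corner_region (C : finType) (pos : pred C) (glue : dart C -> dart C)
  (d : dart C) : {set dart C} :=
  [set x | fconnect (fun y => glue (turn pos y)) d x].

(* Planarity is Euler's formula V - E + F = 2 with V = #|crossing| and
   E = 2 * #|crossing|; it forces the set of crossings to be nonempty. *)
Record diagram := Diagram {
  crossing : finType;
  positive : pred crossing;
  glue : dart crossing -> dart crossing;
  glueK : involutive glue;
  glue_out : forall d, (glue d).2 = ~~ d.2;
  diagram_connected : forall d d' : dart crossing,
    connect [rel x y | (y == turn positive x) || (y == glue x)] d d';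
  diagram_planar :
    #|[set corner_region positive glue d | d : dart crossing]|
      = (#|crossing| + 2)%N }.

Definition region (D : diagram) (d : dart (crossing D)) :
    {set dart (crossing D)} :=
  corner_region (@positive D) (@glue D) d.

(* Each edge of the diagram joins an over end to an under end. *)
Definition alternating (D : diagram) : Prop :=
  forall d : dart (crossing D), (glue d).1.2 = ~~ d.1.2.

(* Incidence data of a connected plane digraph with signed edges: endpoints,
   and the faces on the left and right of each edge. *)

Record plane_digraph := PlaneDigraph {
  vertex : finType;
  edge : finType;
  face : finType;
  source : edge -> vertex;
  target : edge -> vertex;
  left_face : edge -> face;
  right_face : edge -> face;
  pos_edge : pred edge }.

Section PlaneDigraph.
Variable G : plane_digraph.
Implicit Types (A Z T : {set edge G}) (e : edge G) (u v r : vertex G).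
Implicit Types (f g q : face G).

Definition joined_in A u v : bool :=
  connect [rel x y | [exists e in A,
    ((source e == x) && (target e == y)) ||
    ((source e == y) && (target e == x))]] u v.

(* A loop counts twice. *)
Definition degree_in A v : nat :=
  (#|[set e in A | source e == v]| + #|[set e in A | target e == v]|)%N.

Definition is_cycle Z : bool :=
  [&& Z != set0,
      [forall v, (degree_in Z v == 0%N) || (degree_in Z v == 2%N)] &
      [forall e in Z, forall e' in Z, joined_in Z (source e) (source e')]].

Definition spanning_tree T : bool :=
  [forall u, forall v, joined_in T u v] &&
  [forall Z : {set edge G}, (Z \subset T) ==> ~~ is_cycle Z].

(* q lies in the closure of r *)
Definition adjacent r q : bool :=
  [exists e, ((source e == r) || (target e == r)) &&
             ((left_face e == q) || (right_face e == q))].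

(* Faces on the same side of the closed curve Z: one can pass from one to the
   other through edges outside Z. *)
Definition same_side Z f g : bool :=
  connect [rel x y | [exists e in ~: Z,
    ((left_face e == x) && (right_face e == y)) ||
    ((left_face e == y) && (right_face e == x))]] f g.

Definition int_active r T e : bool := joined_in (T :\ e) r (source e).

(* The unique cycle in e |: T when T is a spanning tree and e \notin T. *)
Definition Cyc T e : {set edge G} :=
  odflt set0 [pick Z : {set edge G} | (Z \subset e |: T) && is_cycle Z].

(* Cyc T e has q on its left; e agrees with this orientation iff the left face
   of e is on the same side of Cyc T e as q. *)
Definition ext_active q T e : bool := same_side (Cyc T e) (left_face e) q.

Definition iota_pos r T : nat :=
  #|[set e in T | pos_edge e & int_active r T e]|.
Definition iota_bar_pos r T : nat :=
  #|[set e in T | pos_edge e & ~~ int_active r T e]|.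
Definition eps_neg q T : nat :=
  #|[set e in ~: T | ~~ pos_edge e & ext_active q T e]|.
Definition eps_bar_neg q T : nat :=
  #|[set e in ~: T | ~~ pos_edge e & ~~ ext_active q T e]|.

End PlaneDigraph.

(* The shaded regions are those at the bottom corner (named by the incoming
   over end, SW) and the top corner (named by the outgoing over end, NE) of
   the crossings; the corners at the under ends SE (right) and NW (left) are
   unshaded.  Since D is connected, each face of the Tait digraph contains
   exactly one unshaded region. *)

Section Tait.
Variable D : diagram.

Definition shaded : {set {set dart (crossing D)}} :=
  [set region d | d : dart (crossing D) & d.1.2].
Definition unshaded : {set {set dart (crossing D)}} :=
  [set region d | d : dart (crossing D) & ~~ d.1.2].

Lemma over_shaded (c : crossing D) (t : bool) :
  region ((c, true, t) : dart (crossing D)) \in shaded.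
Proof. by apply: imset_f; rewrite inE. Qed.

Lemma turn_over_unshaded (c : crossing D) (t : bool) :
  region (turn (@positive D) (c, true, t)) \in unshaded.
Proof. by apply: imset_f; rewrite inE. Qed.

Definition shaded_region : finType := {R | R \in shaded}.
Definition unshaded_region : finType := {R | R \in unshaded}.

Definition bottom (c : crossing D) : shaded_region :=
  exist (fun R => R \in shaded) _ (over_shaded c false).
Definition top (c : crossing D) : shaded_region :=
  exist (fun R => R \in shaded) _ (over_shaded c true).
Definition left_region (c : crossing D) : unshaded_region :=
  exist (fun R => R \in unshaded) _ (turn_over_unshaded c true).
Definition right_region (c : crossing D) : unshaded_region :=
  exist (fun R => R \in unshaded) _ (turn_over_unshaded c false).

Definition tait : plane_digraph :=
  PlaneDigraph bottom top left_region right_region (@positive D).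

End Tait.

(* Z[x^-1, y^-1, z, w] is the polynomial ring in the four generators x^-1,
   y^-1, z, w, which are the variables 0, 1, 2, 3 of {mpoly int[4]}. *)

Definition xinv : {mpoly int[4]} := 'X_(inord 0).
Definition yinv : {mpoly int[4]} := 'X_(inord 1).
Definition zvar : {mpoly int[4]} := 'X_(inord 2).
Definition wvar : {mpoly int[4]} := 'X_(inord 3).

Definition tree_poly (G : plane_digraph) (r : vertex G) (q : face G) :
    {mpoly int[4]} :=
  \sum_(T : {set edge G} | spanning_tree T)
    xinv ^+ iota_pos r T * yinv ^+ iota_bar_pos r T *
    zvar ^+ eps_neg q T * wvar ^+ eps_bar_neg q T.

Definition laurent_degree (m : 'X_{1..4}) : int :=
  - (m (inord 0))%:Z - (m (inord 1))%:Z
  + (m (inord 2))%:Z + (m (inord 3))%:Z.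

Definition laurent_homog (d : int) (p : {mpoly int[4]}) : Prop :=
  forall m : 'X_{1..4}, p@_m != 0 -> laurent_degree m = d.

(* F is the surface of Seifert's algorithm: one disk per Seifert circle, all in
   the upper half-space, and one half-twisted band per crossing, oriented so
   that its boundary is the link.

   When both strands at c point upward, the smoothing ") (" of c has a left arc
   from in_left to out_left and a right arc from in_right to out_right. *)

Section SeifertSurface.
Variable D : diagram.
Implicit Types (c : crossing D).

Definition in_left c : dart (crossing D) := (c, positive c, false).
Definition in_right c : dart (crossing D) := (c, ~~ positive c, false).
Definition out_left c : dart (crossing D) := (c, ~~ positive c, true).
Definition out_right c : dart (crossing D) := (c, positive c, true).

(* Cellular 1-chains of F: f d is the coefficient of the edge of the diagram
   with ends d and glue d, directed as the link. *)
Definition chain := {ffun dart (crossing D) -> int}.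

(* What f loses along the left arc at c travels through the band of c, from
   left to right; it is the coefficient of the core of the band. *)
Definition band (f : chain) c : int := f (in_left c) - f (out_left c).

Definition cycle1 (f : chain) : Prop :=
  (forall d, f (glue d) = f d) /\
  (forall c, f (out_right c) = f (in_right c) + band f c).

(* Boundaries of 2-chains of F, i.e. integer combinations of Seifert
   circles. *)
Definition boundary1 (f : chain) : Prop :=
  (forall d, f (glue d) = f d) /\
  (forall c, f (out_left c) = f (in_left c) /\
             f (out_right c) = f (in_right c)).

(* Linking number lk(a, b^+), where b^+ is b pushed off F in the positive normal
   direction.  Near a Seifert circle the disk is vertical, its normal points to
   the right of the circle, so b^+ runs on the right of a; where a enters the
   band of c from the left circle, it passes under b^+, at a crossing of sign
   -1.  The part of b turning into the same band leaves the circle after a (so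
   that a meets all that arrives at c) if c is positive, and before a (so that
   a meets only what continues past c) if c is negative.  These are all the
   crossings where b^+ passes over a. *)
Definition lk_push (a b : chain) : int :=
  - \sum_c band a c * (if positive c then b (in_left c) else b (out_left c)).

(* g induces a basis of the free abelian group H_1(F; Z) = cycles/boundaries. *)
Definition H1_basis (n : nat) (g : 'I_n -> chain) : Prop :=
  (forall i, cycle1 (g i)) /\
  (forall f, cycle1 f ->
     exists! k : {ffun 'I_n -> int}, boundary1 (f - \sum_i g i *~ k i)).

End SeifertSurface.

(* Seifert matrices of the link represented by D: those of the surface of
   Seifert's algorithm, closed under S-equivalence.  By the S-equivalence
   theorem, this includes the matrix of every connected Seifert surface of the
   link. *)
Inductive seifert_matrix (D : diagram) : forall n, 'M[int]_n -> Prop :=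
| Seifert_surface n (g : 'I_n -> chain D) of H1_basis g :
    seifert_matrix D (\matrix_(i, j) lk_push (g i) (g j))
| Seifert_congruence n (V P : 'M[int]_n) of seifert_matrix D V & P \in unitmx :
    seifert_matrix D (P *m V *m P^T)
| Seifert_enlarge_col n (V : 'M[int]_n) (u : 'cV[int]_n) of seifert_matrix D V :
    seifert_matrix D
      (block_mx V (row_mx u 0) 0 (block_mx 0 1%:M 0 0) : 'M_(n + (1 + 1)))
| Seifert_enlarge_row n (V : 'M[int]_n) (u : 'rV[int]_n) of seifert_matrix D V :
    seifert_matrix D
      (block_mx V 0 (col_mx u 0) (block_mx 0 0 1%:M 0) : 'M_(n + (1 + 1)))
| Seifert_reduce_col n (V : 'M[int]_n) (u : 'cV[int]_n) of
    seifert_matrix D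
      (block_mx V (row_mx u 0) 0 (block_mx 0 1%:M 0 0) : 'M_(n + (1 + 1))) :
    seifert_matrix D V
| Seifert_reduce_row n (V : 'M[int]_n) (u : 'rV[int]_n) of
    seifert_matrix D
      (block_mx V 0 (col_mx u 0) (block_mx 0 0 1%:M 0) : 'M_(n + (1 + 1))) :
    seifert_matrix D V.

(* Number of positive minus number of negative eigenvalues, with multiplicity,
   of a symmetric integer matrix. *)
Definition eigenvalues (n : nat) (A : 'M[int]_n) : seq algC :=
  sval (closed_field_poly_normal (char_poly (map_mx intr A : 'M[algC]_n))).

Definition signature (n : nat) (A : 'M[int]_n) : int :=
  (count (fun z => 0 < z) (eigenvalues A))%:Z -
  (count (fun z => z < 0) (eigenvalues A))%:Z.

(* Main.v *)
(* Every spanning tree T of the Tait digraph has #|V| - 1 edges, so its monomial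
   has degree |E_- \ T| - |E_+ :&: T| = |E_-| - |V| + 1, and the point is that
   this number is the signature.

   On the Seifert surface a class in H_1 is a flow on the edges of D modulo
   Seifert circles, i.e. it is determined by its coefficients on the bands.  In
   an alternating diagram every edge joins an over end to an under end, so for
   every function h on the edges of D the sums of h over the incoming over ends
   and over the outgoing under ends agree.  Applied to |f|^2, this turns the
   symmetrized Seifert form of a flow f whose bands all lie at positive
   (negative) crossings into minus (plus) the sum of the |band f c|^2.  Such
   flows arise from functions on the shaded (unshaded) regions, their bands
   being the coboundaries restricted to the positive (negative) crossings.
   Planar duality (cuts of the Tait graph are the cycles of its dual, by Euler's
   formula) shows that together they span H_1, so the signature is a difference
   of two ranks, which duality evaluates to |E_-| - |V| + 1. *)

Require Import Defs.
From mathcomp Require Import all_boot all_order all_algebra all_field.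
From mathcomp Require Import mpoly ring zify.

Set Implicit Arguments.
Unset Strict Implicit.
Unset Printing Implicit Defensive.

Import Order.TTheory GRing.Theory Num.Theory.
Local Open Scope ring_scope.
Local Open Scope sesquilinear_scope.

(** * Inertia of symmetric integer matrices *)

Definition select_mx (F : fieldType) (n : nat) (p : pred 'I_n) : 'M[F]_n :=
  diag_mx (\row_i (p i)%:R).

Lemma rank_select_mx (F : fieldType) (n : nat) (p : pred 'I_n) :
  \rank (select_mx F p) = #|p|.
Proof.
pose Y : 'M[F]_(#|p|, n) := \matrix_(k, i) (enum_val k == i)%:R.
have YY1 : Y *m Y^T = 1%:M.
  apply/matrixP=> k l; rewrite !mxE (bigD1 (enum_val k)) //= big1 ?addr0.
    by rewrite !mxE eqxx mul1r (inj_eq enum_val_inj) eq_sym.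
  by move=> i /negPf nik; rewrite !mxE eq_sym nik mul0r.
have YpY : select_mx F p = Y^T *m Y.
  apply/matrixP=> i j; rewrite !mxE.
  case: (boolP (p i)) => [pi | npi]; last first.
    rewrite mul0rn big1 // => k _; rewrite !mxE.
    case: eqP => [eq_ki | _]; last by rewrite mul0r.
    by have := enum_valP k; rewrite eq_ki unfold_in (negPf npi).
  rewrite (bigD1 (enum_rank_in pi i)) //= big1 ?addr0.
    by rewrite !mxE enum_rankK_in // eqxx mul1r.
  move=> k nki; rewrite !mxE; case: eqP => [eq_ki | _]; last by rewrite mul0r.
  by case/eqP: nki; apply: enum_val_inj; rewrite enum_rankK_in.
apply/eqP; rewrite eqn_leq; apply/andP; split.
  by rewrite YpY mulmx_max_rank.
apply: (@mulmx1_min_rank _ _ _ _ _ Y Y^T).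
by rewrite YpY mulmxA YY1 mul1mx YY1.
Qed.

Lemma mul_select_mx (F : fieldType) (m n : nat) (p : pred 'I_n)
    (A : 'M[F]_(m, n)) i j :
  (A *m select_mx F p) i j = A i j *+ p j.
Proof. by rewrite mul_mx_diag !mxE; case: (p j); rewrite ?mulr1 ?mulr0. Qed.

(** The scalar [s] is meant to be 1 or -1; a strict inequality in [algC] also asserts that the value
    is real. *)
Definition definite_on (n : nat) (s : algC) (A : 'M[algC]_n) (m : nat)
    (U : 'M[algC]_(m, n)) : Prop :=
  forall x : 'rV_n, (x <= U)%MS -> x != 0 -> 0 < s * (x *m A *m x^t*) 0 0.

Definition inertia (s : algC) (n : nat) (A : 'M[int]_n) : nat :=
  count (fun z => 0 < s * z) (eigenvalues A).

Lemma signatureE (n : nat) (A : 'M[int]_n) :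
  signature A = (inertia 1 A)%:Z - (inertia (-1) A)%:Z.
Proof.
rewrite /signature /inertia; congr (_%:Z - _%:Z).
  by apply: eq_count => z; rewrite mul1r.
by apply: eq_count => z; rewrite mulN1r oppr_gt0.
Qed.

Lemma char_poly_eigenvalues (n : nat) (A : 'M[int]_n) :
  char_poly (map_mx intr A : 'M[algC]_n) =
    \prod_(z <- eigenvalues A) ('X - z%:P).
Proof.
rewrite /eigenvalues; case: closed_field_poly_normal => r /= {1}->.
by rewrite (monicP (char_poly_monic _)) scale1r.
Qed.

Lemma size_eigenvalues (n : nat) (A : 'M[int]_n) : size (eigenvalues A) = n.
Proof.
have := size_char_poly (map_mx intr A : 'M[algC]_n).
by rewrite char_poly_eigenvalues size_prod_XsubC => -[].
Qed.

Lemma inertia_le (n : nat) (A : 'M[int]_n) :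
  (inertia 1%R A + inertia (-1)%R A <= n)%N.
Proof.
rewrite /inertia -[leqRHS](size_eigenvalues A) -count_predUI.
rewrite [X in (_ + X)%N](_ : _ = 0%N) ?addn0 ?count_size //.
apply/eqP; rewrite -leqn0 leqNgt -has_count -all_predC; apply/allP => z _ /=.
by apply/andP=> -[]; rewrite mul1r mulN1r oppr_gt0 => /lt_trans h /h; rewrite ltxx.
Qed.

Lemma char_poly_similar (F : fieldType) (n : nat) (P A : 'M[F]_n) :
  P \in unitmx -> char_poly (invmx P *m A *m P) = char_poly A.
Proof.
move=> unitP; rewrite /char_poly /char_poly_mx !map_mxM /=.
have VP : map_mx polyC (invmx P) *m map_mx polyC P = 1%:M.
  by rewrite -map_mxM mulVmx // map_mx1.
have {1}-> : 'X%:M = map_mx polyC (invmx P) *m 'X%:M *m map_mx polyC P.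
  by rewrite scalar_mxC -mulmxA VP mulmx1.
rewrite -mulmxBl -mulmxBr !det_mulmx mulrAC -det_mulmx VP det1 mul1r; exact: erefl.
Qed.

(** A real symmetric matrix is Hermitian, so the spectral theorem applies; similarity preserves the
    characteristic polynomial, hence the list of roots up to order. *)
Lemma spectral_int (n : nat) (A : 'M[int]_n) : A^T = A ->
  exists P : 'M[algC]_n, exists d : 'rV[algC]_n,
    [/\ P \is unitarymx, map_mx intr A = P^t* *m diag_mx d *m P,
        forall i, d 0 i \is Num.real &
        perm_eq (eigenvalues A) [seq d 0 i | i <- enum 'I_n]].
Proof.
move=> symA; set M : 'M[algC]_n := map_mx intr A.
have hermM : M \is hermsymmx.
  apply/is_hermitianmxP; rewrite expr0 scale1r; apply/matrixP=> i j.
  by rewrite !mxE rmorph_int -[in RHS]symA mxE.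
have unitP := spectral_unitarymx M.
have /orthomx_spectralP MP := hermitian_normalmx hermM.
exists (spectralmx M), (spectral_diag M); split=> //.
- by rewrite -invmx_unitary.
- by move=> i; move/mxOverP: (hermitian_spectral_diag_real hermM); apply.
apply: prod_XsubC_eq; rewrite -char_poly_eigenvalues -/M.
rewrite [in LHS]MP big_map big_enum /=.
rewrite char_poly_similar ?spectral_unit //.
rewrite char_poly_trig; last first.
  by apply/is_trig_mxP=> i j lt_ij; rewrite !mxE -val_eqE ltn_eqF.
by apply: eq_bigr => i _; rewrite mxE eqxx.
Qed.

Lemma form_spectral (n : nat) (P : 'M[algC]_n) (d : 'rV_n) (x : 'rV_n) :
  (x *m (P^t* *m diag_mx d *m P) *m x^t*) 0 0 =
    \sum_i d 0 i * `|(x *m P^t*) 0 i| ^+ 2.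
Proof.
set y := x *m P^t*.
have -> : x *m (P^t* *m diag_mx d *m P) *m x^t* = y *m diag_mx d *m y^t*.
  by rewrite /y trmx_mul map_mxM /= trmxCK !mulmxA.
rewrite mxE; apply: eq_bigr => i _.
by rewrite mul_mx_diag !mxE normCK mulrAC mulrC mulrA.
Qed.

(** In spectral coordinates, the projection of [U] to the coordinates with [s * d 0 i] positive is
    injective: on its kernel the form is a sum of nonpositive terms. *)
Lemma inertia_max (n : nat) (s : algC) (A : 'M[int]_n) (m : nat)
    (U : 'M[algC]_(m, n)) :
  A^T = A -> s \is Num.real ->
  definite_on s (map_mx intr A) U -> (\rank U <= inertia s A)%N.
Proof.
move=> symA sR defU; have [P [d [unitP AP dR eqd]]] := spectral_int symA.
have unitPt : P^t* \in unitmx by rewrite unitarymx_unit // trmxC_unitary.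
pose S := select_mx algC (fun i => 0 < s * d 0 i).
have <- : \rank S = inertia s A.
  rewrite rank_select_mx /inertia (permP eqd) count_map.
  by rewrite cardE -size_filter enumT.
have <- : \rank (U *m P^t*) = \rank U by rewrite mxrankMfree ?row_free_unit.
suff /mxrank_injP <- : ((U *m P^t*) :&: kermx S)%MS == 0.
  exact: mxrankM_maxr.
apply/rowV0P=> y; rewrite sub_capmx sub_kermx => /andP[/submxP[z yz] /eqP yS].
pose x := z *m U; have yx : y = x *m P^t* by rewrite yz mulmxA.
have [x0 | nz_x] := eqVneq x 0; first by rewrite yx x0 mul0mx.
have := defU x (submxMl _ _) nz_x.
rewrite AP form_spectral -yx mulr_sumr => /lt_geF/negP[].
apply: sumr_le0 => i _; rewrite mulrA.
have sdR : s * d 0 i \is Num.real by rewrite rpredM.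
have [pos_i | npos_i] := boolP (0 < s * d 0 i).
  have /matrixP/(_ 0 i) := yS; rewrite mul_select_mx pos_i mxE mulr1n => ->.
  by rewrite normr0 expr0n mulr0.
by rewrite mulr_le0_ge0 ?exprn_ge0 // real_leNgt ?real0.
Qed.

Lemma inertia_attained (n : nat) (s : algC) (A : 'M[int]_n) :
  A^T = A -> s \is Num.real ->
  exists2 U : 'M[algC]_n, \rank U = inertia s A &
    definite_on s (map_mx intr A) U.
Proof.
move=> symA sR; have [P [d [unitP AP dR eqd]]] := spectral_int symA.
pose S := select_mx algC (fun i => 0 < s * d 0 i).
exists (S *m P).
  rewrite mxrankMfree ?row_free_unit ?unitarymx_unit // rank_select_mx.
  by rewrite /inertia (permP eqd) count_map cardE -size_filter enumT.
move=> x /submxP[z xz] nz_x; rewrite AP form_spectral mulr_sumr.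
have xP : x *m P^t* = z *m S.
  by rewrite xz -!mulmxA (unitarymxP unitP) mulmx1.
have term_ge0 i : 0 <= s * (d 0 i * `|(x *m P^t*) 0 i| ^+ 2).
  rewrite xP mul_select_mx mulrA; case: (boolP (0 < _)) => [pos_i | _].
    by rewrite mulr_ge0 ?exprn_ge0 // ltW.
  by rewrite normr0 expr0n mulr0.
rewrite lt_def sumr_ge0 // andbT; apply: contra nz_x => /eqP sum0.
have zS0 : z *m S = 0.
  have := psumr_eq0P (fun i _ => term_ge0 i) sum0 => terms0.
  apply/rowP=> i; rewrite [RHS]mxE; have /eqP := terms0 i isT.
  rewrite xP mul_select_mx; case: (boolP (0 < s * d 0 i)) => [pos_i | //].
  by rewrite mulrA mulf_eq0 (gt_eqF pos_i) expf_eq0 normr_eq0 => /eqP.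
by rewrite xz mulmxA zS0 mul0mx.
Qed.

(** [invmx P] carries a definite subspace of maximal rank for [A] to one of the same rank for the
    congruent matrix. This is one half of Sylvester's law of inertia. *)
Lemma inertia_congr_le (n : nat) (s : algC) (A P : 'M[int]_n) :
  A^T = A -> s \is Num.real -> P \in unitmx ->
  (inertia s A <= inertia s (P *m A *m P^T))%N.
Proof.
move=> symA sR unitP; have [U <- defU] := inertia_attained symA sR.
pose Pc : 'M[algC]_n := map_mx intr P.
have unitPc : Pc \in unitmx by rewrite unitmxE det_map_mx rmorph_unit.
rewrite -(mxrankMfree U (_ : row_free (invmx Pc))); last first.
  by rewrite row_free_unit unitmx_inv.
apply: inertia_max => //; first by rewrite !trmx_mul trmxK symA mulmxA.
move=> x xU nz_x.
have xPU : (x *m Pc <= U)%MS by rewrite -(mulmxKV unitPc U) submxMr.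
have nz_xP : x *m Pc != 0.
  by apply: contra nz_x => /eqP xP0; rewrite -(mulmxK unitPc x) xP0 mul0mx.
have := defU _ xPU nz_xP.
rewrite !map_mxM -/Pc trmx_mul map_mxM !mulmxA.
have -> // : Pc^t* = map_mx intr P^T.
by apply/matrixP=> i j; rewrite !mxE rmorph_int.
Qed.

Lemma inertia_congr (n : nat) (s : algC) (A P : 'M[int]_n) :
  A^T = A -> s \is Num.real -> P \in unitmx ->
  inertia s (P *m A *m P^T) = inertia s A.
Proof.
move=> symA sR unitP; apply/eqP; rewrite eqn_leq inertia_congr_le // andbT.
have {2}<- : invmx P *m (P *m A *m P^T) *m (invmx P)^T = A.
  by rewrite !mulmxA mulVmx // mul1mx trmx_inv mulmxK // unitmx_tr.
by rewrite inertia_congr_le ?unitmx_inv // !trmx_mul trmxK symA mulmxA.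
Qed.

Lemma signature_congr (n : nat) (A P : 'M[int]_n) :
  A^T = A -> P \in unitmx -> signature (P *m A *m P^T) = signature A.
Proof.
by move=> symA unitP; rewrite !signatureE !inertia_congr ?rpredN ?rpred1.
Qed.

(** Each rank is at most the corresponding inertia, and the two inertias add up to at most [n]; if
    the ranks already reach [n], these are all equalities. *)
Lemma signature_rank (n p m : nat) (A : 'M[int]_n) (U : 'M[algC]_(p, n))
    (W : 'M[algC]_(m, n)) :
  A^T = A -> definite_on 1 (map_mx intr A) U ->
  definite_on (-1) (map_mx intr A) W -> (n <= \rank U + \rank W)%N ->
  signature A = (\rank U)%:Z - (\rank W)%:Z.
Proof.
move=> symA defU defW le_n; rewrite signatureE.
have leU := inertia_max symA (rpred1 _) defU.
have leW : (\rank W <= inertia (-1)%R A)%N.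
  by apply: inertia_max symA _ defW; rewrite rpredN rpred1.
have := inertia_le A; lia.
Qed.

Lemma eigenvalues_block (n m : nat) (A : 'M[int]_n) (B : 'M[int]_m) :
  perm_eq (eigenvalues (block_mx A 0 0 B)) (eigenvalues A ++ eigenvalues B).
Proof.
apply: prod_XsubC_eq; rewrite -char_poly_eigenvalues big_cat /=.
rewrite -!char_poly_eigenvalues /char_poly map_block_mx !map_mx0.
by rewrite char_block_diag_mx det_ublock.
Qed.

Lemma signature_block (n m : nat) (A : 'M[int]_n) (B : 'M[int]_m) :
  signature (block_mx A 0 0 B) = signature A + signature B.
Proof.
have inertia_block t : inertia t (block_mx A 0 0 B) = (inertia t A + inertia t B)%N.
  by rewrite /inertia (permP (eigenvalues_block A B)) count_cat.
rewrite !signatureE !inertia_block; lia.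
Qed.

(** * Hyperbolic summands and S-equivalence *)

Definition hyperbolic : 'M[int]_(1 + 1) := block_mx 0 1%:M 1%:M 0.

Lemma signature_hyperbolic : signature hyperbolic = 0.
Proof.
have symH : hyperbolic^T = hyperbolic.
  by rewrite /hyperbolic tr_block_mx !trmx0 !trmx1.
pose v (s : algC) : 'rV[algC]_(1 + 1) := row_mx 1%:M s%:M.
have nz_v s : v s != 0.
  by apply/eqP=> /(congr1 lsubmx); rewrite row_mxKl => /matrixP/(_ 0 0)/eqP;
     rewrite !mxE oner_eq0.
have def_v s : s \is Num.real -> s ^+ 2 = 1 ->
    definite_on s (map_mx intr hyperbolic) (v s).
  move=> sR s2 x /sub_rVP[a ->] nz_x.
  have nz_a : a != 0 by apply: contraNneq nz_x => ->; rewrite scale0r.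
  have -> : map_mx intr hyperbolic = block_mx 0 1%:M 1%:M 0 :> 'M[algC]_(1 + 1).
    by rewrite map_block_mx !map_mx0 !map_mx1.
  have -> : (a *: v s *m block_mx 0 1%:M 1%:M 0 *m (a *: v s)^t* ) 0 0 =
      `|a| ^+ 2 * s *+ 2.
    rewrite -scalemxAl mul_row_block !mulmx0 add0r addr0 !mulmx1.
    rewrite [in X in _ *m X]linearZ map_mxZ /= -scalemxAr -!scalemxAl.
    rewrite [LHS]mxE [X in _ * X]mxE.
    rewrite /v tr_row_mx map_col_mx mul_row_col !tr_scalar_mx !map_scalar_mx /=.
    rewrite (CrealP sR) rmorph1 mulmx1 mul1mx !mxE !eqxx !mulr1n.
    by rewrite normCK; ring.
  by rewrite -mulrnAl mulrCA -expr2 s2 mulr1 pmulrn_lgt0 // exprn_gt0 ?normr_gt0.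
have rank_v s : \rank (v s) = 1%N by rewrite rank_rV nz_v.
have d1 := def_v 1 (rpred1 _) (expr1n _ _).
have dN : definite_on (-1) (map_mx intr hyperbolic) (v (-1)).
  by apply: def_v; rewrite ?sqrrN ?expr1n ?rpredN ?rpred1.
by rewrite (signature_rank symH d1 dN) !rank_v ?subrr.
Qed.

Lemma signature_enlarge (n : nat) (A : 'M[int]_n) (u : 'cV[int]_n) :
  A^T = A ->
  signature (block_mx A (row_mx u 0) (col_mx u^T 0) hyperbolic) = signature A.
Proof.
move=> symA.
(* [P] adds multiples, given by [u], of the second hyperbolic vector to the old basis. That vector
   pairs to 1 with the first one and is isotropic, so [A] itself is unchanged. *)
pose P : 'M[int]_(n + (1 + 1)) := block_mx 1%:M (row_mx 0 u) 0 1%:M.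
have unitP : P \in unitmx by rewrite unitmxE det_ublock !det1 mulr1 unitr1.
have symAH : (block_mx A 0 0 hyperbolic)^T = block_mx A 0 0 hyperbolic.
  by rewrite !tr_block_mx !trmx0 !trmx1 symA.
rewrite -[RHS]addr0 -signature_hyperbolic -signature_block.
rewrite -(signature_congr symAH unitP); congr signature.
rewrite /P tr_block_mx tr_row_mx !trmx1 !trmx0 !mulmx_block.
rewrite !(mulmx0, mul0mx, mul1mx, mulmx1, addr0, add0r) /hyperbolic.
rewrite mul_row_block mul_row_col mul_block_col.
by rewrite !(mulmx0, mul0mx, mul1mx, mulmx1, addr0, add0r).
Qed.

(* S-equivalence changes V + V^T by a congruence or a hyperbolic summand. *)
Lemma signature_seifert (D : diagram) (s : int) :
  (forall n (g : 'I_n -> chain D), H1_basis g ->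
     let V := \matrix_(i, j) lk_push (g i) (g j) in signature (V + V^T) = s) ->
  forall n (V : 'M[int]_n), seifert_matrix D V -> signature (V + V^T) = s.
Proof.
move=> surf; have sym n (V : 'M[int]_n) : (V + V^T)^T = V + V^T.
  by rewrite linearD /= trmxK addrC.
move=> n V; elim => {n V}.
- by move=> n g; apply: surf.
- move=> n V P _ <- unitP; rewrite -(signature_congr (sym _ V) unitP).
  by congr signature; rewrite !trmx_mul trmxK mulmxDr mulmxDl mulmxA.
- move=> n V u _ <-; rewrite -(signature_enlarge u (sym _ V)); congr signature.
  rewrite !tr_block_mx tr_row_mx !trmx0 trmx1 add_block_mx add_block_mx.
  by rewrite !(addr0, add0r).
- move=> n V u _ <-; rewrite -(signature_enlarge u^T (sym _ V)); congr signature.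
  rewrite !tr_block_mx tr_col_mx !trmx0 trmx1 trmxK add_block_mx add_block_mx.
  by rewrite !(addr0, add0r).
- move=> n V u _ <-; rewrite -(signature_enlarge u (sym _ V)); congr signature.
  rewrite !tr_block_mx tr_row_mx !trmx0 trmx1 add_block_mx add_block_mx.
  by rewrite !(addr0, add0r).
move=> n V u _ <-; rewrite -(signature_enlarge u^T (sym _ V)); congr signature.
rewrite !tr_block_mx tr_col_mx !trmx0 trmx1 trmxK add_block_mx add_block_mx.
by rewrite !(addr0, add0r).
Qed.

(** * Incidence matrices and spanning trees *)

Definition incmx (F : fieldType) (V E : finType) (s t : E -> V) :
    'M[F]_(#|V|, #|E|) :=
  \matrix_(i, j) ((s (enum_val j) == enum_val i)%:R -
                  (t (enum_val j) == enum_val i)%:R).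

Definition rowf (F : fieldType) (I : finType) (f : I -> F) : 'rV[F]_#|I| :=
  \row_i f (enum_val i).

Definition select_mxf (F : fieldType) (I : finType) (A : pred I) : 'M[F]_#|I| :=
  select_mx F (fun i => A (enum_val i)).

Lemma rank_select_mxf (F : fieldType) (I : finType) (A : pred I) :
  \rank (select_mxf F A) = #|A|.
Proof.
rewrite rank_select_mx; transitivity (\sum_(i : 'I_#|I| | A (enum_val i)) 1)%N.
  by rewrite sum1_card.
by rewrite -[RHS]sum1_card [RHS](reindex _ (onW_bij _ (@enum_val_bij I))).
Qed.

Lemma rowf_inj (F : fieldType) (I : finType) (f g : I -> F) :
  rowf f = rowf g -> f =1 g.
Proof.
by move=> /rowP fg i; have := fg (enum_rank i); rewrite !mxE enum_rankK.
Qed.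

Lemma eq_rowf (F : fieldType) (I : finType) (f g : I -> F) :
  f =1 g -> rowf f = rowf g.
Proof. by move=> fg; apply/rowP=> i; rewrite !mxE fg. Qed.

Lemma rowf0 (F : fieldType) (I : finType) : rowf (fun _ : I => 0 : F) = 0.
Proof. by apply/rowP=> i; rewrite !mxE. Qed.

Lemma rowfP (F : fieldType) (I : finType) (v : 'rV[F]_#|I|) :
  exists f : I -> F, v = rowf f.
Proof.
by exists (fun i => v 0 (enum_rank i)); apply/rowP=> i; rewrite mxE enum_valK.
Qed.

Lemma rowf_select (F : fieldType) (I : finType) (A : pred I) (f : I -> F) :
  rowf f *m select_mxf F A = rowf (fun i => f i *+ A i).
Proof. by apply/rowP=> i; rewrite mul_select_mx !mxE. Qed.

Lemma rowf_incmx (F : fieldType) (V E : finType) (s t : E -> V) (f : V -> F) :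
  rowf f *m incmx F s t = rowf (fun e => f (s e) - f (t e)).
Proof.
apply/rowP=> j; rewrite !mxE.
transitivity (\sum_x f x * ((s (enum_val j) == x)%:R - (t (enum_val j) == x)%:R)).
  rewrite [RHS](reindex _ (onW_bij _ (@enum_val_bij V))) /=.
  by apply: eq_bigr => i _; rewrite !mxE.
have sum_delta u : \sum_x f x * (u == x)%:R = f u.
  rewrite (bigD1 u) //= eqxx mulr1 big1 ?addr0 // => x /negPf nx.
  by rewrite eq_sym nx mulr0.
by under eq_bigr => x _ do rewrite mulrBr; rewrite sumrB !sum_delta.
Qed.

(** The left kernel consists of the functions on [V] with equal values at both ends of each edge in
    [A]; connectedness, phrased through such functions, makes it the line of constants. *)
Lemma rank_incmx_select (F : fieldType) (V E : finType) (s t : E -> V)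
    (A : pred E) (r : V) :
  (forall f : V -> F, (forall e, A e -> f (s e) = f (t e)) ->
     forall x y, f x = f y) ->
  (\rank (incmx F s t *m select_mxf F A)).+1 = #|V|.
Proof.
move=> connA; set M := _ *m _.
have V_gt0 : (0 < #|V|)%N by apply/card_gt0P; exists r.
suff rker : \rank (kermx M) = 1%N.
  by have := rank_leq_row M; move: rker; rewrite mxrank_ker; lia.
have fM f : rowf f *m M = rowf (fun e => (f (s e) - f (t e)) *+ A e).
  by rewrite mulmxA rowf_incmx rowf_select.
have sub1 : (rowf (fun _ : V => 1 : F) <= kermx M)%MS.
  by rewrite sub_kermx fM -rowf0; apply/eqP/eq_rowf=> e; rewrite subrr mul0rn.
have nz1 : rowf (fun _ : V => 1 : F) != 0.
  by rewrite -rowf0; apply/eqP=> /rowf_inj/(_ r)/eqP; rewrite oner_eq0.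
have rank1 : \rank (rowf (fun _ : V => 1 : F)) = 1%N by rewrite rank_rV nz1.
apply: etrans rank1; apply/eqP; rewrite eqn_leq !mxrankS //.
apply/rV_subP=> v; have [f ->] := rowfP v; rewrite sub_kermx fM -rowf0.
move=> /eqP/rowf_inj f0; apply/sub_rVP; exists (f r).
apply/rowP=> i; rewrite !mxE mulr1; apply: connA => e Ae; apply/eqP.
by rewrite -subr_eq0; have := f0 e; rewrite Ae mulr1n => ->.
Qed.

Lemma rank_incmx (F : fieldType) (V E : finType) (s t : E -> V) (r : V) :
  (forall f : V -> F, (forall e, f (s e) = f (t e)) -> forall x y, f x = f y) ->
  (\rank (incmx F s t)).+1 = #|V|.
Proof.
move=> conn; apply: etrans (rank_incmx_select (F := F) (A := xpredT) r _).
  by congr (\rank _).+1; apply/matrixP=> i j; rewrite mul_select_mx mulr1n.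
by move=> f fe; apply: conn => e; apply: fe.
Qed.

(** * Cycles and the number of edges of a spanning tree *)

Lemma joined_in_sym (G : plane_digraph) (A : {set edge G}) :
  connect_sym [rel x y | [exists e in A,
    ((source e == x) && (target e == y)) ||
    ((source e == y) && (target e == x))]].
Proof.
apply: sym_connect_sym => x y /=.
by apply: eq_existsb => e; rewrite orbC.
Qed.

Lemma joined_inS (G : plane_digraph) (A B : {set edge G}) (x y : vertex G) :
  A \subset B -> joined_in A x y -> joined_in B x y.
Proof.
move=> sAB; apply: connect_sub => u v /exists_inP[e Ae uv].
by apply: connect1; apply/exists_inP; exists e => //; apply: (subsetP sAB).
Qed.

Lemma joined_in_edge (G : plane_digraph) (A : {set edge G}) (e : edge G) :
  e \in A -> joined_in A (source e) (target e).
Proof. by move=> Ae; apply: connect1; apply/exists_inP; exists e; rewrite ?eqxx. Qed.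

Lemma joined_in_potential (T : Type) (G : plane_digraph) (A : {set edge G})
    (f : vertex G -> T) (x y : vertex G) :
  (forall e, e \in A -> f (source e) = f (target e)) ->
  joined_in A x y -> f x = f y.
Proof.
move=> fA /connectP[p + ->] {y}; elim: p x => [|z p IHp] x //=.
case/andP=> /exists_inP[e Ae xz] /IHp <-; have fe := fA e Ae.
by case/orP: xz => /andP[/eqP <- /eqP <-].
Qed.

Lemma degree_in_setU1 (G : plane_digraph) (Z : {set edge G}) (e : edge G) w :
  e \notin Z ->
  degree_in (e |: Z) w = ((source e == w) + (target e == w) + degree_in Z w)%N.
Proof.
move=> eZ; rewrite /degree_in.
have card_U1 (h : edge G -> vertex G) :
    #|[set x in e |: Z | h x == w]| = ((h e == w) + #|[set x in Z | h x == w]|)%N.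
  case: (boolP (h e == w)) => he.
    rewrite (_ : [set x in _ | _] = e |: [set x in Z | h x == w]).
      by rewrite cardsU1 inE (negPf eZ).
    by apply/setP=> x; rewrite !inE; case: (x =P e) => // ->; rewrite he.
  apply: eq_card => x; rewrite !inE; case: (x =P e) => //= ->.
  by rewrite (negPf he) andbF.
by rewrite !card_U1; lia.
Qed.

(** Adding the indicators of the two ends to the degree makes one formula cover inner vertices, ends
    and the trivial path; closing the path by an edge then gives degree 2 along it. *)
Lemma simple_path_edges (G : plane_digraph) (A : {set edge G}) (x : vertex G) p :
  path [rel x y | [exists e in A,
    ((source e == x) && (target e == y)) ||
    ((source e == y) && (target e == x))]] x p -> uniq (x :: p) ->
  exists2 Z : {set edge G}, Z \subset A &
    [/\ forall w, (degree_in Z w + (w == x) + (w == last x p) = 2 * (w \in x :: p))%N,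
        forall e, e \in Z -> (source e \in x :: p) && (target e \in x :: p) &
        forall w, w \in x :: p -> joined_in Z x w].
Proof.
elim: p x => [|y p IHp] x.
  move=> _ _; exists set0; first exact: sub0set.
  split=> [w|e|w]; rewrite ?inE //; last by move/eqP->; apply: connect0.
  by rewrite /degree_in !eq_card0 => [|e|e]; rewrite ?inE //; case: eqP.
move=> /andP[/exists_inP[e Ae xy] yp] /andP[xNp uniq_yp].
have [Z sZA [degZ endZ joinZ]] := IHp y yp uniq_yp.
have eZ : e \notin Z.
  apply: contra xNp => /endZ/andP[se te].
  by case/orP: xy => /andP[/eqP ex /eqP ey]; [rewrite -ex | rewrite -ey].
exists (e |: Z); first by rewrite subUset sub1set Ae.
have sources w : ((source e == w) + (target e == w) = (w == x) + (w == y))%N.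
  by case/orP: xy => /andP[/eqP-> /eqP->]; rewrite !(eq_sym _ w) // addnC.
split.
- move=> w; rewrite degree_in_setU1 // sources [_ \in _ :: _]in_cons /=.
  have := degZ w; have [->|_] := eqVneq w x; rewrite ?(negPf xNp) /=.
    move: (degree_in Z x) (x == y) (x == last y p) => d b1 b2; clear; lia.
  move: (degree_in Z w) (w == y) (w == last y p) (w \in y :: p) => d b1 b2 b3.
  by clear; lia.
- move=> e'; rewrite in_setU1 => /predU1P[->{e'}|/endZ/andP[h1 h2]].
    by case/orP: xy => /andP[/eqP-> /eqP->]; rewrite !inE !eqxx ?orbT.
  by rewrite !(in_cons x) h1 h2 !orbT.
move=> w; rewrite in_cons => /predU1P[->|/joinZ yw]; first exact: connect0.
apply: connect_trans (joined_inS (subsetUr _ _) yw).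
by apply: connect1; apply/exists_inP; exists e; rewrite ?setU11.
Qed.

(** A simple path in [T :\ e] between the ends of [e], closed up by [e], is the cycle; if [e] is a
    loop, the path is trivial and the loop alone has degree 2. *)
Lemma acyclic_joined (G : plane_digraph) (T : {set edge G}) (e : edge G) :
  e \in T -> joined_in (T :\ e) (target e) (source e) ->
  exists2 Z : {set edge G}, Z \subset T & is_cycle Z.
Proof.
move=> Te /connectP[p0 path_p0]; case/shortenP: path_p0 => p path_p uniq_p _ last_p.
have [Z sZ [degZ endZ joinZ]] := simple_path_edges path_p uniq_p.
have eZ : e \notin Z by apply/negP=> /(subsetP sZ); rewrite setD11.
exists (e |: Z); first by rewrite subUset sub1set Te (subset_trans sZ) ?subsetDl.
have degZe w : degree_in (e |: Z) w = (2 * (w \in target e :: p))%N.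
  by rewrite degree_in_setU1 // -degZ -last_p !(eq_sym w); lia.
apply/and3P; split.
- by apply/set0Pn; exists e; rewrite setU11.
- by apply/forallP=> w; rewrite degZe; case: (w \in _).
have in_path e' : e' \in e |: Z -> source e' \in target e :: p.
  rewrite in_setU1 => /predU1P[->|/endZ/andP[] //].
  by rewrite last_p mem_last.
apply/forall_inP=> e1 /in_path/joinZ join1; apply/forall_inP=> e2 /in_path/joinZ join2.
apply: joined_inS (subsetUr [set e] Z) _.
by apply: connect_trans join2; rewrite (joined_in_sym Z).
Qed.

(** The rank of the incidence matrix restricted to [T] is computed twice: from connectedness, and
    from acyclicity, which makes the columns in [T] independent. *)
Lemma card_spanning_tree (G : plane_digraph) (T : {set edge G}) (r : vertex G) :
  spanning_tree T -> #|T|.+1 = #|vertex G|.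
Proof.
case/andP=> /forallP joinT /forallP acyclicT.
pose s := @source G; pose t := @target G; pose A := [pred e | e \in T].
rewrite -(rank_incmx_select (F := rat) (s := s) (t := t) (A := A) r); last first.
  by move=> f fT x y; exact: joined_in_potential fT (forallP (joinT x) y).
congr _.+1; transitivity (\rank (select_mxf rat A)); first by rewrite rank_select_mxf.
apply/eqP; rewrite eqn_leq mxrankM_maxr andbT mxrankS //.
apply/row_subP=> i; set e := enum_val i.
have [Te | nTe] := boolP (e \in T); last first.
  rewrite (_ : row i _ = 0) ?sub0mx //.
  by apply/rowP=> j; rewrite !mxE /= (negPf nTe) mul0rn.
have not_joined : ~~ joined_in (T :\ e) (target e) (source e).
  apply/negP=> /(acyclic_joined Te)[Z sZT cycZ].
  by have := acyclicT Z; rewrite sZT cycZ.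
(* Minus the indicator of the component of [target e] in [T :\ e]: among the edges of [T] its
   coboundary is nonzero only on [e], where it is 1. *)
pose f v : rat := - (joined_in (T :\ e) (target e) v)%:R.
apply/submxP; exists (rowf f); rewrite mulmxA rowf_incmx rowf_select.
apply/rowP=> j; rewrite !mxE; set e' := enum_val j.
rewrite [LHS](_ : _ = (e' == e)%:R); last first.
  by rewrite /= Te mulr1n (inj_eq enum_val_inj) eq_sym.
rewrite /A /=; have [-> | ne'] := eqVneq e' e.
  by rewrite /f (negPf not_joined) [joined_in _ _ _]connect0 Te opprK add0r.
have [Te' | _] := boolP (e' \in T); last by rewrite mulr0n.
rewrite mulr1n /f; have je : joined_in (T :\ e) (s e') (t e').
  by rewrite joined_in_edge // !inE ne'.
suff -> : joined_in (T :\ e) (target e) (s e') = joined_in (T :\ e) (target e) (t e').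
  by rewrite subrr.
by apply/idP/idP => /connect_trans; apply => //; rewrite (joined_in_sym (T :\ e)).
Qed.

(** * Homogeneity of the tree polynomial *)

Lemma laurent_homog_monomial (a b c d : nat) (k : int) :
  - a%:Z - b%:Z + c%:Z + d%:Z = k ->
  laurent_homog k (xinv ^+ a * yinv ^+ b * zvar ^+ c * wvar ^+ d).
Proof.
move=> <- m; rewrite /xinv /yinv /zvar /wvar !mpolyXn -!mpolyXD mcoeffX.
case: (_ =P m) => [<- _ | _]; last by rewrite eqxx.
rewrite /laurent_degree !mnmDE !mulmnE !mnm1E -!val_eqE /= !inordK //=; lia.
Qed.

Lemma laurent_homog_sum (I : finType) (P : pred I) (F : I -> {mpoly int[4]}) k :
  (forall i, P i -> laurent_homog k (F i)) -> laurent_homog k (\sum_(i | P i) F i).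
Proof.
move=> homF; elim/big_ind: _ => [m | p1 p2 hom1 hom2 m | i /homF //].
  by rewrite mcoeff0 eqxx.
rewrite mcoeffD; have [-> | /hom1 //] := eqVneq (p1@_m) 0.
by rewrite add0r; apply: hom2.
Qed.

Lemma card_predI_split (T : finType) (A P Q : pred T) :
  (#|[set x | A x]| = #|[set x | [&& A x, P x & Q x]]| +
    #|[set x | [&& A x, P x & ~~ Q x]]| + #|[set x | A x && ~~ P x]|)%N.
Proof.
rewrite -(cardsID [set x | P x]) -(cardsID [set x | Q x] (_ :&: _)).
by congr (_ + _ + _)%N; apply: eq_card => x; rewrite !inE;
   case: (A x); case: (P x); case: (Q x).
Qed.

(** Activities only split the positive edges in [T] and the negative edges outside [T]. The negative
    edges in [T] cancel between the counts of [T] and of all negative edges. *)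
Lemma tree_poly_homog (G : plane_digraph) (r : vertex G) (q : face G) :
  laurent_homog (#|[pred e : edge G | ~~ pos_edge e]|%:Z - #|vertex G|%:Z + 1)
    (tree_poly r q).
Proof.
apply: laurent_homog_sum => T treeT; apply: laurent_homog_monomial.
have := card_spanning_tree r treeT.
have -> : #|T| = #|[set e | e \in T]| by apply: eq_card => e; rewrite inE.
have /= -> := card_predI_split (fun e => e \in T) (@pos_edge G) (int_active r T).
have -> : #|[pred e : edge G | ~~ pos_edge e]| = #|[set e : edge G | ~~ pos_edge e]|.
  by apply: eq_card => e; rewrite !inE.
have /= -> := card_predI_split (fun e => ~~ pos_edge e) (fun e => e \notin T)
                (ext_active q T).
have -> : [set e | [&& ~~ pos_edge e, e \notin T & ext_active q T e]] =
    [set e in ~: T | ~~ pos_edge e & ext_active q T e].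
  by apply/setP=> e; rewrite !inE andbCA.
have -> : [set e | [&& ~~ pos_edge e, e \notin T & ~~ ext_active q T e]] =
    [set e in ~: T | ~~ pos_edge e & ~~ ext_active q T e].
  by apply/setP=> e; rewrite !inE andbCA.
have -> : [set e | ~~ pos_edge e && ~~ (e \notin T)] =
    [set e in T | ~~ pos_edge e].
  by apply/setP=> e; rewrite !inE negbK andbC.
rewrite -!/(iota_pos r T) -!/(iota_bar_pos r T) -!/(eps_neg q T) -!/(eps_bar_neg q T).
move: (iota_pos r T) (iota_bar_pos r T) (eps_neg q T) (eps_bar_neg q T) #|_| #|_|.
clear; lia.
Qed.

(** * Regions of an alternating diagram *)

Lemma turn4 (C : finType) (pos : pred C) (d : dart C) :
  turn pos (turn pos (turn pos (turn pos d))) = d.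
Proof. by case: d => [[c o] t]; rewrite /turn; case: o t (pos c) => [] [] []. Qed.

Lemma turn_inj (C : finType) (pos : pred C) : injective (turn pos).
Proof.
exact: (can_inj (g := fun d => turn pos (turn pos (turn pos d))) (@turn4 C pos)).
Qed.

Lemma turn_over (C : finType) (pos : pred C) (d : dart C) :
  (turn pos d).1.2 = ~~ d.1.2.
Proof. by case: d => [[]]. Qed.

Lemma region_glue_turn (D : diagram) (d : dart (crossing D)) :
  region (glue (turn (@positive D) d)) = region d.
Proof.
pose step (y : dart (crossing D)) := glue (turn (@positive D) y).
have step_inj : injective step by move=> y z /(inv_inj (@glueK D)) /turn_inj.
by apply/setP=> x; rewrite !inE (same_fconnect1 step_inj d x).
Qed.

(* The strand end d lies between the corner d and the preceding one, of which
   exactly one is named by an over end. *)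
Definition corner (D : diagram) (o : bool) (d : dart (crossing D)) :
    dart (crossing D) :=
  if d.1.2 == o then d else iter 3 (turn (@positive D)) d.

Lemma region_corner_glue (D : diagram) (o : bool) (d : dart (crossing D)) :
  alternating D -> region (corner o (glue d)) = region (corner o d).
Proof.
(* By alternation exactly one of [d] and [glue d] names its own corner, say [d]; the corner
   preceding [glue d] is then one step before [d] on the walk around the region. *)
move=> alt; wlog over_d: d / d.1.2 = o => [IH | ].
  case: (d.1.2 =P o) => [/IH // | nover].
  rewrite -[in RHS](glueK d); apply/esym/IH; rewrite alt.
  by move: nover; case: (d.1.2) (o) => [] [].
rewrite /corner alt over_d eqxx; case: eqP => [|_]; first by case: (o).
by rewrite -region_glue_turn /= turn4 glueK.
Qed.

(** The region of [corner true d], spelled out through [top] and [bottom] so that Tait edges can be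
    handled by cases on the crossing. *)
Definition shaded_side (D : diagram) (d : dart (crossing D)) : shaded_region D :=
  let: (c, o, t) := d in
  if (if o then t else t == positive c) then top c else bottom c.

Definition unshaded_side (D : diagram) (d : dart (crossing D)) :
    unshaded_region D :=
  let: (c, o, t) := d in
  if (if o then ~~ t else t == positive c) then left_region c else right_region c.

Lemma val_shaded_side (D : diagram) (d : dart (crossing D)) :
  sval (shaded_side d) = region (corner true d).
Proof.
case: d => [[c o] t]; rewrite /corner /=; case: o => /=; first by case: t.
by rewrite /turn /=; case: (positive c) t => [] [].
Qed.

Lemma val_unshaded_side (D : diagram) (d : dart (crossing D)) :
  sval (unshaded_side d) = region (corner false d).
Proof.
case: d => [[c o] t]; rewrite /corner /=; case: o => /=.
  by case: t; rewrite /= /turn; case Ec: (positive c); rewrite /= ?Ec /=.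
by case: t; rewrite /= /turn; case Ec: (positive c); rewrite /= ?Ec /=.
Qed.

Lemma shaded_side_glue (D : diagram) (d : dart (crossing D)) :
  alternating D -> shaded_side (glue d) = shaded_side d.
Proof. by move=> alt; apply: val_inj; rewrite /= !val_shaded_side region_corner_glue. Qed.

Lemma unshaded_side_glue (D : diagram) (d : dart (crossing D)) :
  alternating D -> unshaded_side (glue d) = unshaded_side d.
Proof.
by move=> alt; apply: val_inj; rewrite /= !val_unshaded_side region_corner_glue.
Qed.

Lemma shaded_side_surj (D : diagram) (R : shaded_region D) :
  exists d, shaded_side d = R.
Proof.
case: R => R sR; have /imsetP[d] := sR; rewrite inE => over_d defR.
by exists d; apply: val_inj; rewrite /= val_shaded_side /corner over_d.
Qed.

Lemma unshaded_side_surj (D : diagram) (R : unshaded_region D) :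
  exists d, unshaded_side d = R.
Proof.
case: R => R sR; have /imsetP[d] := sR; rewrite inE => /negPf under_d defR.
by exists d; apply: val_inj; rewrite /= val_unshaded_side /corner under_d.
Qed.

Lemma dart_potential (T : Type) (D : diagram) (h : dart (crossing D) -> T) :
  (forall d, h (turn (@positive D) d) = h d) -> (forall d, h (glue d) = h d) ->
  forall d d', h d = h d'.
Proof.
move=> h_turn h_glue d d'; have /connectP[p + ->] := diagram_connected d d'.
elim: p d => [|e p IHp] d //= /andP[/orP[] /eqP def_e /IHp <-].
  by rewrite def_e h_turn.
by rewrite def_e h_glue.
Qed.

(** The pullback of [f] to darts is invariant under [turn] and [glue], so connectedness of the
    diagram passes to the Tait graph. *)
Lemma shaded_potential (T : Type) (D : diagram) (f : shaded_region D -> T) :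
  alternating D -> (forall c, f (bottom c) = f (top c)) -> forall R R', f R = f R'.
Proof.
move=> alt fc R R'.
have [[d <-] [d' <-]] := (shaded_side_surj R, shaded_side_surj R').
apply: (dart_potential (h := fun d => f (shaded_side d))) => [[[c o] t] | e].
  by rewrite /=; do 2!case: ifP => _; rewrite ?fc.
by rewrite shaded_side_glue.
Qed.

Lemma unshaded_potential (T : Type) (D : diagram) (f : unshaded_region D -> T) :
  alternating D -> (forall c, f (left_region c) = f (right_region c)) ->
  forall R R', f R = f R'.
Proof.
move=> alt fc R R'.
have [[d <-] [d' <-]] := (unshaded_side_surj R, unshaded_side_surj R').
apply: (dart_potential (h := fun d => f (unshaded_side d))) => [[[c o] t] | e].
  by rewrite /=; do 2!case: ifP => _; rewrite ?fc.
by rewrite unshaded_side_glue.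
Qed.

(** A step around a region applies [turn] and [glue], each exchanging over and under. Hence no
    region is both shaded and unshaded. *)
Lemma region_over (D : diagram) (d d' : dart (crossing D)) :
  alternating D -> d' \in region d -> d'.1.2 = d.1.2.
Proof.
move=> alt; rewrite inE => /connectP[p + ->]; elim: p d => [|e p IHp] d //=.
by case/andP=> /eqP <- /IHp ->; rewrite alt turn_over negbK.
Qed.

Lemma card_regions (D : diagram) : alternating D ->
  (#|shaded_region D| + #|unshaded_region D| = #|crossing D| + 2)%N.
Proof.
move=> alt; rewrite !card_sig -diagram_planar.
have -> : [set corner_region (@positive D) (@glue D) d | d : dart (crossing D)] =
    shaded D :|: unshaded D.
  apply/setP=> R; rewrite inE; apply/imsetP/orP=> [[d _ ->]|].
    by case: (boolP d.1.2) => over_d; [left|right]; apply: imset_f; rewrite inE.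
  by case=> /imsetP[d _ ->]; exists d.
rewrite cardsU (_ : shaded D :&: unshaded D = set0) ?cards0 ?subn0 //.
apply/setP=> R; rewrite !inE; apply/andP=> -[/imsetP[d + ->] /imsetP[d']].
rewrite !inE => over_d /negP under_d' eq_dd'; apply: under_d'.
have : d' \in region d by rewrite eq_dd' inE connect0.
by move/(region_over alt) => ->.
Qed.

(** * Flows on the Seifert surface *)

Lemma sum_over_under (K : zmodType) (D : diagram) (h : dart (crossing D) -> K) t :
  alternating D -> (forall d, h (glue d) = h d) ->
  \sum_c h (c, true, t) = \sum_c h (c, false, ~~ t).
Proof.
move=> alt h_glue; pose k c := (glue ((c, true, t) : dart (crossing D))).1.1.
have glue_k c : glue ((c, true, t) : dart (crossing D)) = (k c, false, ~~ t).
  have := glue_out ((c, true, t) : dart (crossing D)).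
  have := alt (c, true, t).
  by rewrite /k; case: (glue _) => [[c' o'] t'] /= -> ->.
have k_inj : injective k.
  move=> c c' kcc'; have := glueK ((c, true, t) : dart (crossing D)).
  by rewrite glue_k kcc' -glue_k glueK => -[].
rewrite [RHS](reindex_inj k_inj) /=.
by apply: eq_bigr => c _; rewrite -h_glue glue_k.
Qed.

Section Flow.
Variables (K : comPzRingType) (D : diagram).
Implicit Types (f : dart (crossing D) -> K) (c : crossing D).

Definition flow_band f c : K := f (in_left c) - f (out_left c).

Definition is_flow f : Prop :=
  (forall d, f (glue d) = f d) /\
  (forall c, f (out_right c) = f (in_right c) + flow_band f c).

(* The flow with potential u on the shaded regions and 0 on the unshaded ones is
   the potential on the right minus the potential on the left of each edge; the
   shaded region is on the right of an incoming over or outgoing under end. *)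
Definition shaded_flow (u : shaded_region D -> K) (d : dart (crossing D)) : K :=
  (-1) ^+ (d.1.2 == d.2) * u (shaded_side d).

Definition unshaded_flow (u : unshaded_region D -> K) (d : dart (crossing D)) : K :=
  (-1) ^+ (d.1.2 != d.2) * u (unshaded_side d).

Hypothesis alt : alternating D.

Lemma shaded_flowP u : is_flow (shaded_flow u).
Proof.
split=> [d | c]; rewrite /shaded_flow.
  by rewrite shaded_side_glue // alt glue_out; case: d.1.2 d.2 => [] [].
rewrite /flow_band /in_left /in_right /out_left /out_right /=.
by case Ec: (positive c); rewrite /= ?Ec /= ?expr0 ?expr1; ring.
Qed.

Lemma unshaded_flowP u : is_flow (unshaded_flow u).
Proof.
split=> [d | c]; rewrite /unshaded_flow.
  by rewrite unshaded_side_glue // alt glue_out; case: d.1.2 d.2 => [] [].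
rewrite /flow_band /in_left /in_right /out_left /out_right /=.
by case Ec: (positive c); rewrite /= ?Ec /= ?expr0 ?expr1; ring.
Qed.

(** At a positive crossing the left arc of the smoothing has [bottom] and then [top] on its right;
    at a negative one it has [top] on its left throughout, so nothing is lost along it. *)
Lemma band_shaded_flow u c :
  flow_band (shaded_flow u) c = (u (bottom c) - u (top c)) *+ positive c.
Proof.
rewrite /shaded_flow /flow_band /in_left /out_left /=.
by case Ec: (positive c); rewrite /= ?Ec /= ?expr0 ?expr1; ring.
Qed.

Lemma band_unshaded_flow u c :
  flow_band (unshaded_flow u) c =
    (u (left_region c) - u (right_region c)) *+ ~~ positive c.
Proof.
rewrite /unshaded_flow /flow_band /in_left /out_left /=.
by case Ec: (positive c); rewrite /= ?Ec /= ?expr0 ?expr1; ring.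
Qed.

(** Cuts of the Tait graph are orthogonal to cuts of its dual: each product expands into one term
    per strand end, and over ends cancel against under ends. *)
Lemma tait_orthogonal (u : shaded_region D -> K) (v : unshaded_region D -> K) :
  \sum_c (u (bottom c) - u (top c)) * (v (left_region c) - v (right_region c)) = 0.
Proof.
pose h (d : dart (crossing D)) := u (shaded_side d) * v (unshaded_side d).
have h_glue d : h (glue d) = h d.
  by rewrite /h shaded_side_glue // unshaded_side_glue.
transitivity (\sum_c ((h (c, true, false) - h (c, false, true)) +
                      (h (c, true, true) - h (c, false, false)))).
  apply: eq_bigr => c _; rewrite /h /=.
  by case Ec: (positive c); rewrite /= ?Ec /=; ring.
by rewrite big_split /= !sumrB !sum_over_under // !subrr addr0.
Qed.

(** Summation by parts. At a positive crossing the two arcs run along [left_region] and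
    [right_region], so the four ends give the summand; at a negative one [v] agrees on both sides
    and conservation cancels the ends. *)
Lemma flow_unshaded f (v : unshaded_region D -> K) :
  is_flow f -> (forall c, ~~ positive c -> v (left_region c) = v (right_region c)) ->
  \sum_c flow_band f c * (v (left_region c) - v (right_region c)) = 0.
Proof.
move=> [f_glue flow_f] vc.
pose h (d : dart (crossing D)) := v (unshaded_side d) * f d.
have h_glue d : h (glue d) = h d by rewrite /h f_glue unshaded_side_glue.
transitivity (\sum_c ((h (c, true, false) - h (c, false, true)) -
                      (h (c, true, true) - h (c, false, false)))).
  apply: eq_bigr => c _; have := flow_f c; have := vc c; rewrite /h.
  rewrite /flow_band /in_left /in_right /out_left /out_right /=.
  case Ec: (positive c); rewrite /= ?Ec /= => vE fE; first by ring: fE.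
  by rewrite vE //; ring: fE.
by rewrite sumrB !sumrB !sum_over_under // !subrr.
Qed.

Lemma flow_shaded f (u : shaded_region D -> K) :
  is_flow f -> (forall c, positive c -> u (bottom c) = u (top c)) ->
  \sum_c flow_band f c * (u (bottom c) - u (top c)) = 0.
Proof.
move=> [f_glue flow_f] uc.
pose h (d : dart (crossing D)) := u (shaded_side d) * f d.
have h_glue d : h (glue d) = h d by rewrite /h f_glue shaded_side_glue.
transitivity (- \sum_c ((h (c, true, false) - h (c, false, true)) -
                      (h (c, true, true) - h (c, false, false)))).
  rewrite -sumrN; apply: eq_bigr => c _; have := flow_f c; have := uc c; rewrite /h.
  rewrite /flow_band /in_left /in_right /out_left /out_right /=.
  case Ec: (positive c); rewrite /= ?Ec /= => uE fE; last by ring: fE.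
  by rewrite uE //; ring: fE.
by rewrite sumrB !sumrB !sum_over_under // !subrr oppr0.
Qed.

End Flow.

Definition push_coef (K : Type) (D : diagram) (f : dart (crossing D) -> K) c : K :=
  if positive c then f (in_left c) else f (out_left c).

(** The Hermitian extension of [lk_push], evaluated on the pair of [f] with itself. *)
Definition flow_form (D : diagram) (f : dart (crossing D) -> algC) : algC :=
  - \sum_c flow_band f c * (push_coef f c)^*.

Lemma flow_form_pos (D : diagram) (f : dart (crossing D) -> algC) :
  alternating D -> is_flow f ->
  (forall c, ~~ positive c -> flow_band f c = 0) ->
  flow_form f + (flow_form f)^* = - \sum_c `|flow_band f c| ^+ 2.
Proof.
move=> alt [f_glue flow_f] band0.
pose h (d : dart (crossing D)) := `|f d| ^+ 2.
have h_glue d : h (glue d) = h d by rewrite /h f_glue.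
(* The added sum is zero by alternation. For [a] and [b] on the incoming and outgoing left ends of a
   positive crossing, twice the real part of [a - b] times the conjugate of [a] is
   [|a - b|^2 + |a|^2 - |b|^2]. *)
have <- : - (\sum_c `|flow_band f c| ^+ 2 +
          \sum_c (h (c, true, false) - h (c, false, true))) =
        - \sum_c `|flow_band f c| ^+ 2.
  by rewrite sumrB sum_over_under // subrr addr0.
rewrite /flow_form rmorphN rmorph_sum -opprD -!big_split /=; congr (- _).
apply: eq_bigr => c _; rewrite /h !normCK /push_coef.
move: (flow_f c) (band0 c); rewrite /flow_band.
rewrite /in_left /in_right /out_left /out_right.
case Ec: (positive c) => /= fE bE; first by rewrite !rmorphM !rmorphB /= conjCK; ring.
by rewrite fE bE // !(mul0r, rmorph0, addr0, subrr).
Qed.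

Lemma flow_form_neg (D : diagram) (f : dart (crossing D) -> algC) :
  alternating D -> is_flow f ->
  (forall c, positive c -> flow_band f c = 0) ->
  flow_form f + (flow_form f)^* = \sum_c `|flow_band f c| ^+ 2.
Proof.
move=> alt [f_glue flow_f] band0.
pose h (d : dart (crossing D)) := `|f d| ^+ 2.
have h_glue d : h (glue d) = h d by rewrite /h f_glue.
(* At negative crossings the pushed-off coefficient is the outgoing one; exchanging the two ends in
   the identity reverses the sign. *)
have <- : \sum_c `|flow_band f c| ^+ 2 +
          \sum_c (h (c, true, true) - h (c, false, false)) =
        \sum_c `|flow_band f c| ^+ 2.
  by rewrite sumrB sum_over_under // subrr addr0.
rewrite /flow_form rmorphN rmorph_sum -!sumrN -!big_split /=.
apply: eq_bigr => c _; rewrite /h !normCK /push_coef.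
move: (flow_f c) (band0 c); rewrite /flow_band.
rewrite /in_left /in_right /out_left /out_right.
case Ec: (positive c) => /= fE bE; last by rewrite !rmorphM !rmorphB /= conjCK; ring.
by rewrite fE bE // !(mul0r, rmorph0, addr0, subrr, oppr0).
Qed.

(** * Linear duality between a plane graph and its dual *)

Lemma eqmx_ker_dual (F : fieldType) (m p c : nat) (A : 'M[F]_(m, c))
    (B : 'M[F]_(p, c)) :
  A *m B^T = 0 -> (c <= \rank A + \rank B)%N -> (A :=: kermx B^T)%MS.
Proof.
move=> AB0 le_c; apply/eqmxP; rewrite -mxrank_leqif_eq.
  by rewrite mxrank_ker mxrank_tr eqn_leq; have := mulmx0_rank_max AB0;
     rewrite mxrank_tr; lia.
by apply/sub_kermxP.
Qed.

Lemma tr_select_mx (F : fieldType) (n : nat) (p : pred 'I_n) :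
  (select_mx F p)^T = select_mx F p.
Proof. exact: tr_diag_mx. Qed.

Lemma kermx_select (F : fieldType) (n : nat) (p : pred 'I_n) :
  (kermx (select_mx F p) :=: select_mx F (predC p))%MS.
Proof.
apply: eqmx_sym; rewrite -[in kermx _]tr_select_mx.
apply: eqmx_ker_dual; last by rewrite !rank_select_mx addnC cardC card_ord.
apply/matrixP=> i j; rewrite tr_select_mx mul_select_mx !mxE /=.
by case: eqP => [->|_]; case: (p j); rewrite ?mulr0n ?mul0rn.
Qed.

(* A and B play the coboundary matrices of a plane graph and of its dual. *)
Lemma rank_dual_select (F : fieldType) (m k n : nat) (A : 'M[F]_(m, n))
    (B : 'M[F]_(k, n)) (p : pred 'I_n) :
  A *m B^T = 0 -> (n <= \rank A + \rank B)%N ->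
  (\rank (B *m select_mx F (predC p)) + \rank A =
    \rank (A *m select_mx F p) + #|predC p|)%N.
Proof.
move=> AB0 le_n; have eqA := eqmx_ker_dual AB0 le_n.
rewrite -(rank_select_mx F (predC p)) -(mxrank_mul_ker A (select_mx F p)).
rewrite -(mxrank_mul_ker (select_mx F (predC p)) B^T).
have -> : \rank (B *m select_mx F (predC p)) = \rank (select_mx F (predC p) *m B^T).
  by rewrite -mxrank_tr trmx_mul tr_select_mx.
(* Both intersections consist of the vectors in the row space of [A] that vanish on [p]. *)
have -> : \rank (A :&: kermx (select_mx F p)) =
    \rank (select_mx F (predC p) :&: kermx B^T).
  by rewrite capmxC (cap_eqmx (kermx_select F p) eqA).
lia.
Qed.

(** A functional supported on [p] that kills [A] lies in the row space of [B], so by hypothesis it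
    kills [X]; thus [X] satisfies every equation of the restricted row space. *)
Lemma sub_select_dual (F : fieldType) (m k n l : nat) (A : 'M[F]_(m, n))
    (B : 'M[F]_(k, n)) (p : pred 'I_n) (X : 'M[F]_(l, n)) :
  A *m B^T = 0 -> (n <= \rank A + \rank B)%N ->
  (forall v : 'rV_k, v *m B *m select_mx F (predC p) = 0 -> X *m (v *m B)^T = 0) ->
  (X *m select_mx F p <= A *m select_mx F p)%MS.
Proof.
move=> AB0 le_n XB; have BA0 : B *m A^T = 0.
  by rewrite -[LHS]trmxK trmx_mul trmxK AB0 trmx0.
have eqB := eqmx_ker_dual BA0 (_ : n <= _ + _)%N; rewrite addnC in eqB.
rewrite submxE; set K := cokermx _.
have : (K^T *m select_mx F p <= B)%MS.
  rewrite eqB // sub_kermx -[select_mx F p]tr_select_mx -mulmxA -trmx_mul.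
  by rewrite -trmx_mul mulmx_coker trmx0.
case/submxP=> Psi defPsi.
rewrite -mulmxA -[X in X == 0]trmxK trmx_mul.
have -> : (select_mx F p *m K)^T = Psi *m B by rewrite trmx_mul tr_select_mx.
suff -> : Psi *m B *m X^T = 0 by rewrite trmx0.
apply/row_matrixP=> i; rewrite row0 !row_mul.
rewrite -[LHS]trmxK trmx_mul trmxK XB ?trmx0 //.
rewrite -row_mul -defPsi -row_mul -mulmxA.
rewrite (_ : _ *m select_mx F (predC p) = 0) ?mulmx0 ?row0 //.
apply/matrixP=> i1 j1; rewrite mul_select_mx !mxE /=.
by case: eqP => [->|_]; case: (p j1); rewrite ?mulr0n ?mul0rn.
Qed.

(** * The signature of the Seifert form *)

Definition is_pos (D : diagram) : pred 'I_#|crossing D| :=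
  fun i => positive (enum_val i).

Definition shaded_mx (D : diagram) : 'M[algC]_(#|shaded_region D|, #|crossing D|) :=
  incmx algC (@bottom D) (@top D).

Definition unshaded_mx (D : diagram) :
    'M[algC]_(#|unshaded_region D|, #|crossing D|) :=
  incmx algC (@left_region D) (@right_region D).

Definition band_mx (D : diagram) (n : nat) (g : 'I_n -> chain D) :
    'M[algC]_(n, #|crossing D|) :=
  \matrix_(i, j) (flow_band (g i) (enum_val j))%:~R.

Definition push_mx (D : diagram) (n : nat) (g : 'I_n -> chain D) :
    'M[algC]_(n, #|crossing D|) :=
  \matrix_(i, j) (push_coef (g i) (enum_val j))%:~R.

Lemma shaded_unshaded_mx (D : diagram) :
  alternating D -> shaded_mx D *m (unshaded_mx D)^T = 0.
Proof.
move=> alt; apply/matrixP=> k l; rewrite mxE [RHS]mxE.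
have := tait_orthogonal (K := algC) alt
  (fun R => (R == enum_val k)%:R) (fun R => (R == enum_val l)%:R).
rewrite (reindex _ (onW_bij _ (@enum_val_bij (crossing D)))) /= => {2}<-.
by apply: eq_bigr => j _; rewrite !mxE.
Qed.

Lemma rank_shaded_mx (D : diagram) (R : shaded_region D) :
  alternating D -> (\rank (shaded_mx D)).+1 = #|shaded_region D|.
Proof. by move=> alt; apply: (rank_incmx R) => f; apply: shaded_potential. Qed.

Lemma rank_unshaded_mx (D : diagram) (R : unshaded_region D) :
  alternating D -> (\rank (unshaded_mx D)).+1 = #|unshaded_region D|.
Proof. by move=> alt; apply: (rank_incmx R) => f; apply: unshaded_potential. Qed.

(** Each rank is one less than the number of regions of its colour, and Euler's formula counts two
    more regions than crossings. *)
Lemma rank_tait_mx (D : diagram) (R : shaded_region D) (R' : unshaded_region D) :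
  alternating D ->
  (#|crossing D| <= \rank (shaded_mx D) + \rank (unshaded_mx D))%N.
Proof.
move=> alt; have := rank_shaded_mx R alt; have := rank_unshaded_mx R' alt.
have := card_regions alt.
move: (\rank (shaded_mx D)) (\rank (unshaded_mx D)) => a b.
move: #|shaded_region D| #|unshaded_region D| #|crossing D|; clear; lia.
Qed.

Lemma is_flow_intr (D : diagram) (f : dart (crossing D) -> int) :
  is_flow f -> is_flow (fun d => (f d)%:~R : algC).
Proof.
move=> [f_glue flow_f]; split=> [d | c]; first by rewrite f_glue.
by rewrite flow_f /flow_band rmorphD rmorphB.
Qed.

Lemma is_flow_sum (K : comPzRingType) (D : diagram) (I : finType) (x : I -> K)
    (f : I -> dart (crossing D) -> K) :
  (forall i, is_flow (f i)) -> is_flow (fun d => \sum_i x i * f i d).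
Proof.
move=> flow_f; split=> [d | c]; first by apply: eq_bigr => i _; rewrite (flow_f i).1.
rewrite /flow_band -sumrB -big_split /=; apply: eq_bigr => i _.
by rewrite (flow_f i).2 /flow_band; ring.
Qed.

Lemma flow_band_sum (K : comPzRingType) (D : diagram) (I : finType) (x : I -> K)
    (f : I -> dart (crossing D) -> K) c :
  flow_band (fun d => \sum_i x i * f i d) c = \sum_i x i * flow_band (f i) c.
Proof. by rewrite /flow_band -sumrB; apply: eq_bigr => i _; rewrite mulrBr. Qed.

(** Without band coefficients a cycle is constant along each Seifert circle; so a class in H_1 is
    determined by its bands. *)
Lemma boundary_flow (D : diagram) (f : chain D) :
  cycle1 f -> boundary1 f <-> (forall c, flow_band f c = 0).
Proof.
move=> [f_glue flow_f]; split=> [[_ bf] c | bf].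
  by rewrite /flow_band (bf c).1 subrr.
split=> // c; rewrite flow_f [band f c]bf addr0; split=> //.
by apply/eqP; rewrite eq_sym -subr_eq0; apply/eqP/bf.
Qed.

Lemma sum_chainE (D : diagram) (n : nat) (g : 'I_n -> chain D) (k : 'I_n -> int) d :
  (\sum_i g i *~ k i) d = \sum_i k i * g i d.
Proof.
rewrite sum_ffunE; apply: eq_bigr => i _.
by rewrite ffunMzE -mulrzl intz.
Qed.

Lemma cycle_sub_band_mx (D : diagram) (n : nat) (g : 'I_n -> chain D)
    (f : dart (crossing D) -> int) :
  H1_basis g -> is_flow f ->
  (rowf (fun c => (flow_band f c)%:~R : algC) <= band_mx g)%MS.
Proof.
move=> [cyc_g gen_g] flow_f; pose ff : chain D := [ffun d => f d].
have ffE : ff =1 f by move=> d; rewrite ffunE.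
have cyc_ff : cycle1 ff.
  case: flow_f => f_glue flow_f; split=> [d | c]; first by rewrite !ffE.
  by rewrite /band !ffE flow_f.
have [k [[_ bk] _]] := gen_g ff cyc_ff.
apply/submxP; exists (\row_i (k i)%:~R); apply/rowP=> j; rewrite !mxE.
under eq_bigr => i _ do rewrite !mxE -intrM.
rewrite -rmorph_sum -flow_band_sum; congr _%:~R.
have [+ _] := bk (enum_val j); rewrite !ffunE !sum_chainE /flow_band => bj.
move: bj; move: (\sum_i k i * g i (in_left _)) (\sum_i k i * g i (out_left _)).
by move: (f (in_left _)) (f (out_left _)); clear; lia.
Qed.

(** The basis property concerns integer coefficients, so independence is reduced to [rat], where a
    relation can be cleared of denominators. *)
Lemma row_free_band_mx (D : diagram) (n : nat) (g : 'I_n -> chain D) :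
  H1_basis g -> row_free (band_mx g).
Proof.
move=> [cyc_g gen_g].
pose B : 'M[rat]_(n, #|crossing D|) :=
  \matrix_(i, j) (flow_band (g i) (enum_val j))%:~R.
have -> : band_mx g = map_mx ratr B.
  by apply/matrixP=> i j; rewrite !mxE ratr_int.
rewrite row_free_map -kermx_eq0; apply/rowV0P=> v /sub_kermxP vB0.
pose a := \prod_j denq (v 0 j).
have nz_a : a != 0 by apply/prodf_neq0=> j _; apply: denq_neq0.
pose k := [ffun i => numq (v 0 i) * \prod_(j | j != i) denq (v 0 j)].
have kE i : (k i)%:~R = v 0 i * a%:~R.
  by rewrite ffunE /a [in RHS](bigD1 i) //= !intrM numqE mulrA.
have kB c : \sum_i k i * flow_band (g i) c = 0.
  apply: (intr_inj (R := rat)); rewrite rmorph_sum rmorph0 /=.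
  have /rowP/(_ (enum_rank c)) := vB0; rewrite !mxE => /(congr1 (fun x => x * a%:~R)).
  rewrite mul0r mulr_suml => vBj; rewrite -[RHS]vBj; apply: eq_bigr => i _.
  by rewrite intrM kE !mxE enum_rankK mulrAC.
have cyc0 : cycle1 (0 : chain D) by split=> [d | c]; rewrite /band !ffunE.
have [k0 [_ uniq_k]] := gen_g 0 cyc0.
(* An integer relation between the bands yields a bounding combination, i.e. coordinates of the zero
   class; by uniqueness [k] and 0 coincide. *)
have bound (l : {ffun 'I_n -> int}) :
    (forall c, \sum_i l i * flow_band (g i) c = 0) -> k0 = l.
  move=> lB; apply: uniq_k.
  have lE d : (0 - \sum_i g i *~ l i) d = - \sum_i l i * g i d.
    by rewrite !ffunE add0r sum_chainE.
  apply/boundary_flow.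
    have [S_glue flow_S] := is_flow_sum l (f := fun i => g i : dart _ -> int) cyc_g.
    by split=> [d | c]; rewrite ?/band !lE ?S_glue // flow_S /flow_band; ring.
  move=> c; rewrite /flow_band !lE -opprD; apply/eqP; rewrite oppr_eq0.
  by rewrite -[X in _ == X](lB c) -flow_band_sum.
have k_eq0 : k = 0.
  rewrite -(bound k kB); apply: bound => c.
  by rewrite big1 // => i _; rewrite ffunE mul0r.
apply/rowP=> i; apply/eqP; rewrite mxE; have := kE i.
rewrite k_eq0 ffunE => /esym/eqP; rewrite mulf_eq0 intr_eq0 (negPf nz_a) orbF.
by [].
Qed.

Lemma shaded_sub_band_mx (D : diagram) (n : nat) (g : 'I_n -> chain D) :
  alternating D -> H1_basis g ->
  (shaded_mx D *m select_mx algC (@is_pos D) <= band_mx g)%MS.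
Proof.
move=> alt bas_g; apply/row_subP=> k.
pose u R : int := (R == enum_val k)%:R.
have := cycle_sub_band_mx bas_g (shaded_flowP alt u); congr (_ <= _)%MS.
apply/rowP=> j; rewrite [RHS]mxE mul_select_mx !mxE band_shaded_flow /u /is_pos.
by rewrite rmorphMn rmorphB /= !rmorph_nat.
Qed.

Lemma unshaded_sub_band_mx (D : diagram) (n : nat) (g : 'I_n -> chain D) :
  alternating D -> H1_basis g ->
  (unshaded_mx D *m select_mx algC (predC (@is_pos D)) <= band_mx g)%MS.
Proof.
move=> alt bas_g; apply/row_subP=> k.
pose u R : int := (R == enum_val k)%:R.
have := cycle_sub_band_mx bas_g (unshaded_flowP alt u); congr (_ <= _)%MS.
apply/rowP=> j; rewrite [RHS]mxE mul_select_mx !mxE band_unshaded_flow /u /is_pos.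
by rewrite rmorphMn rmorphB /= !rmorph_nat.
Qed.

Lemma band_mx_mul_row (D : diagram) (n : nat) (g : 'I_n -> chain D)
    (b : crossing D -> algC) i :
  (band_mx g *m (rowf b)^T) i 0 = \sum_c (flow_band (g i) c)%:~R * b c.
Proof.
rewrite mxE [RHS](reindex _ (onW_bij _ (@enum_val_bij (crossing D)))) /=.
by apply: eq_bigr => j _; rewrite !mxE.
Qed.

Lemma flow_band_intr (D : diagram) (f : dart (crossing D) -> int) c :
  flow_band (fun d => (f d)%:~R : algC) c = (flow_band f c)%:~R.
Proof. by rewrite /flow_band rmorphB. Qed.

(** By [flow_unshaded], bands are orthogonal to the dual cuts supported on positive crossings, so
    duality makes their positive part a restricted cut; the negative part is symmetric. *)
Lemma band_mx_sub (D : diagram) (n : nat) (g : 'I_n -> chain D)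
    (R : shaded_region D) (R' : unshaded_region D) :
  alternating D -> H1_basis g ->
  (band_mx g <= shaded_mx D *m select_mx algC (@is_pos D) +
                unshaded_mx D *m select_mx algC (predC (@is_pos D)))%MS.
Proof.
move=> alt [cyc_g _].
have flow_g i : is_flow (fun d => (g i d)%:~R : algC) by apply/is_flow_intr/cyc_g.
have AB0 := shaded_unshaded_mx alt; have le_c := rank_tait_mx R R' alt.
have BA0 : unshaded_mx D *m (shaded_mx D)^T = 0.
  by rewrite -[LHS]trmxK trmx_mul trmxK AB0 trmx0.
have predCC : select_mx algC (predC (predC (@is_pos D))) = select_mx algC (@is_pos D).
  by congr diag_mx; apply/rowP=> j; rewrite !mxE /= negbK.
have -> : band_mx g = band_mx g *m select_mx algC (@is_pos D) +
    band_mx g *m select_mx algC (predC (@is_pos D)).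
  apply/matrixP=> i j; rewrite [RHS]mxE !mul_select_mx /=.
  by case: (is_pos j); rewrite ?addr0 ?add0r.
apply: addmx_sub_adds.
  apply: sub_select_dual AB0 le_c _ => v; have [u ->] := rowfP v.
  rewrite rowf_incmx => /rowP u0; apply/colP=> i; rewrite band_mx_mul_row mxE.
  under eq_bigr => c _ do rewrite -flow_band_intr.
  apply: flow_unshaded => // c npos; apply/eqP; rewrite -subr_eq0.
  have := u0 (enum_rank c).
  by rewrite mul_select_mx !mxE enum_rankK /is_pos /= enum_rankK npos mulr1n => ->.
rewrite addnC in le_c.
apply: sub_select_dual BA0 le_c _ => v; have [u ->] := rowfP v.
rewrite predCC rowf_incmx => /rowP u0; apply/colP=> i; rewrite band_mx_mul_row mxE.
under eq_bigr => c _ do rewrite -flow_band_intr.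
apply: flow_shaded => // c pos; apply/eqP; rewrite -subr_eq0.
have := u0 (enum_rank c).
by rewrite mul_select_mx !mxE enum_rankK /is_pos /= enum_rankK pos mulr1n => ->.
Qed.

Definition lk_mx (D : diagram) (n : nat) (g : 'I_n -> chain D) : 'M[int]_n :=
  \matrix_(i, j) lk_push (g i) (g j).

Lemma lk_mxE (D : diagram) (n : nat) (g : 'I_n -> chain D) :
  map_mx intr (lk_mx g) = - (band_mx g *m (push_mx g)^T).
Proof.
apply/matrixP=> i j; rewrite !mxE rmorphN rmorph_sum /=; congr (- _).
rewrite (reindex _ (onW_bij _ (@enum_val_bij (crossing D)))) /=.
by apply: eq_bigr => c _; rewrite !mxE intrM.
Qed.

Definition lift_flow (D : diagram) (n : nat) (g : 'I_n -> chain D)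
    (x : 'rV[algC]_n) (d : dart (crossing D)) : algC :=
  \sum_i x 0 i * (g i d)%:~R.

Lemma lift_flowP (D : diagram) (n : nat) (g : 'I_n -> chain D) x :
  H1_basis g -> is_flow (lift_flow g x).
Proof. by move=> [cyc_g _]; apply: is_flow_sum => i; apply/is_flow_intr/cyc_g. Qed.

Lemma band_lift_flow (D : diagram) (n : nat) (g : 'I_n -> chain D) x c :
  flow_band (lift_flow g x) c = (x *m band_mx g) 0 (enum_rank c).
Proof.
rewrite flow_band_sum mxE; apply: eq_bigr => i _.
by rewrite flow_band_intr mxE enum_rankK.
Qed.

Lemma push_lift_flow (D : diagram) (n : nat) (g : 'I_n -> chain D) x c :
  push_coef (lift_flow g x) c = (x *m push_mx g) 0 (enum_rank c).
Proof.
rewrite mxE /push_coef /lift_flow; under [RHS]eq_bigr => i _ do rewrite mxE enum_rankK.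
by rewrite /push_coef; case: ifP.
Qed.

Lemma form_lift_flow (D : diagram) (n : nat) (g : 'I_n -> chain D) (x : 'rV[algC]_n) :
  (x *m map_mx intr (lk_mx g + (lk_mx g)^T) *m x^t*) 0 0 =
    flow_form (lift_flow g x) + (flow_form (lift_flow g x))^*.
Proof.
pose L : 'M[algC]_n := map_mx intr (lk_mx g).
have formE : (x *m L *m x^t*) 0 0 = flow_form (lift_flow g x).
  rewrite /L lk_mxE mulmxN mulNmx mxE /flow_form; congr (- _).
  have -> : x *m (band_mx g *m (push_mx g)^T) *m x^t* =
      (x *m band_mx g) *m (x *m push_mx g)^t*.
    rewrite [in RHS]trmx_mul map_mxM !mulmxA; congr (_ *m _ *m _).
    by apply/matrixP=> i j; rewrite !mxE rmorph_int.
  rewrite mxE [RHS](reindex _ (onW_bij _ (@enum_val_bij (crossing D)))) /=.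
  by apply: eq_bigr => j _; rewrite band_lift_flow push_lift_flow !enum_valK !mxE.
have -> : map_mx intr (lk_mx g + (lk_mx g)^T) = L + L^t*.
  by apply/matrixP=> i j; rewrite !mxE rmorphD /= rmorph_int.
rewrite mulmxDr mulmxDl mxE -formE; congr (_ + _).
have -> : x *m L^t* *m x^t* = (x *m L *m x^t* )^t*.
  by rewrite !trmx_mul !map_mxM trmxCK mulmxA.
by rewrite !mxE.
Qed.

(** Independence of the bands of a basis leaves some nonzero band on a nonzero class. *)
Lemma flow_norm_gt0 (D : diagram) (n : nat) (g : 'I_n -> chain D) (x : 'rV[algC]_n) :
  H1_basis g -> x != 0 -> 0 < \sum_c `|flow_band (lift_flow g x) c| ^+ 2.
Proof.
move=> bas_g nz_x; rewrite lt_def sumr_ge0 => [|c _]; last exact: exprn_ge0.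
rewrite andbT; apply: contra nz_x => /eqP sum0.
have band0 := psumr_eq0P (fun c _ => exprn_ge0 2 (normr_ge0 _)) sum0.
suff : x *m band_mx g = 0.
  by move/eqP; rewrite mulmx_free_eq0 // row_free_band_mx.
apply/rowP=> j; rewrite [RHS]mxE -(enum_valK j) -band_lift_flow.
by apply/eqP; rewrite -normr_eq0 -sqrf_eq0; apply/eqP/band0.
Qed.

Lemma signature_seifert_surface (D : diagram) (n : nat) (g : 'I_n -> chain D)
    (R : shaded_region D) (R' : unshaded_region D) :
  alternating D -> H1_basis g ->
  signature (lk_mx g + (lk_mx g)^T) =
    #|[pred c : crossing D | ~~ positive c]|%:Z - #|shaded_region D|%:Z + 1.
Proof.
move=> alt bas_g; set M := lk_mx g + _.
have symM : M^T = M by rewrite linearD /= trmxK addrC.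
have free_g := row_free_band_mx bas_g.
(* [X] and [Y] hold the coordinates in the basis [g] of the shaded and unshaded flows, with bands at
   positive and negative crossings respectively. *)
have /submxP[X defX] := shaded_sub_band_mx alt bas_g.
have /submxP[Y defY] := unshaded_sub_band_mx alt bas_g.
have defXneg : definite_on (-1) (map_mx intr M) X.
  move=> x /submxP[z xz] nz_x; rewrite form_lift_flow flow_form_pos //.
  - by rewrite mulN1r opprK flow_norm_gt0.
  - exact: lift_flowP.
  move=> c npos; rewrite band_lift_flow xz -mulmxA -defX mulmxA mul_select_mx.
  by rewrite /is_pos enum_rankK (negPf npos) mulr0n.
have defYpos : definite_on 1 (map_mx intr M) Y.
  move=> x /submxP[z xz] nz_x; rewrite form_lift_flow flow_form_neg //.
  - by rewrite mul1r flow_norm_gt0.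
  - exact: lift_flowP.
  move=> c pos; rewrite band_lift_flow xz -mulmxA -defY mulmxA mul_select_mx.
  by rewrite /= /is_pos enum_rankK pos mulr0n.
have rX : \rank X = \rank (shaded_mx D *m select_mx algC (@is_pos D)).
  by rewrite defX mxrankMfree.
have rY : \rank Y = \rank (unshaded_mx D *m select_mx algC (predC (@is_pos D))).
  by rewrite defY mxrankMfree.
have le_n : (n <= \rank Y + \rank X)%N.
  rewrite rX rY addnC -[X in (X <= _)%N](eqP free_g).
  apply: leq_trans (mxrankS (band_mx_sub R R' alt bas_g)) _.
  exact: mxrank_adds_leqif.
rewrite (signature_rank symM defYpos defXneg le_n) rX rY.
(* Duality turns the difference of ranks into the number of negative crossings minus the rank of
   [shaded_mx]. *)
have := rank_dual_select (@is_pos D) (shaded_unshaded_mx alt) (rank_tait_mx R R' alt).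
have -> : #|predC (@is_pos D)| = #|[pred c : crossing D | ~~ positive c]|.
  rewrite -[RHS](rank_select_mxf algC) rank_select_mx.
  by apply: eq_card => i.
have := rank_shaded_mx R alt.
move: (\rank (_ *m _)) (\rank (_ *m _)) (\rank _) => a b c.
by move: #|_| #|_|; clear; lia.
Qed.

Theorem proposition4p3 (D : diagram) (D_alt : alternating D)
  (r : vertex (tait D)) (q : face (tait D)) (r_q : adjacent r q)
  (n : nat) (V : 'M[int]_n) (V_seifert : seifert_matrix D V) :
  laurent_homog (signature (V + V^T)) (tree_poly r q).
Proof.
have sigV : signature (V + V^T) = #|[pred e : edge (tait D) | ~~ pos_edge e]|%:Z
    - #|vertex (tait D)|%:Z + 1.
  apply: (signature_seifert _ V_seifert) => m g bas_g.
  (* [r] and [q] serve as a shaded and an unshaded region, so that both region counts exceed the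
     ranks by exactly one. *)
  exact: signature_seifert_surface r q D_alt bas_g.
by rewrite sigV; apply: tree_poly_homog.
Qed.
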